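(* Let $d,D\ge1$ and $L\ge2$ be integers, let $\mathcal X\subset\mathbb R^d$ be nonempty with base point $\mathrm e\in\mathcal X$, and let $x_1,\dots,x_N\in\mathcal X$ be distinct. Let $G:(\mathbb R^D)^N\to[0,+\infty]$ be proper, lower semicontinuous, and coercive, and let $\lambda>0$. Let $R_L$ be the extended representation cost of depth-$L$ ReLU networks with weight decay and $\mathcal F_L=\{f\in\mathrm{Lip}(\mathcal X;\mathbb R^D):R_L(f)<+\infty\}$. Consider the function-space problem $$\min_{f\in\mathcal F_L}\ G\big(f(x_1),\dots,f(x_N)\big)+\lambda R_L(f).\qquad(\mathrm P)$$ Then the solution set of $(\mathrm P)$ is nonempty, and there exists a minimizer $f^\star$ of $(\mathrm P)$ realized by a finite-width depth-$L$ ReLU network; moreover $f^\star$ may be chosen so that $f^\star=f_{\theta^\star}$ for some $\theta^\star\in\Theta_L(N^2)$, where $\Theta_L(K)$ denotes the set of parameters of depth-$L$ ReLU networks whose hidden-layer widths are at most $K$. Moreover, for every $K\ge N^2$, the problem $$\min_{\theta=((W_\ell,b_\ell))_{\ell=1}^L\in\Theta_L(K)}\ G\big(f_\theta(x_1),\dots,f_\theta(x_N)\big)+\frac{\lambda}{L}\sum_{\ell=1}^L\|W_\ell\|_F^2$$ has a nonempty solution set, and for any solution $\theta^\star$ of it, $f_{\theta^\star}$ is a solution of $(\mathrm P)$.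
   Context: **Lipschitz space and weak\* topology.** $\mathcal X\subset\mathbb R^d$ carries the Euclidean metric. $\mathrm{Lip}(\mathcal X;\mathbb R^D)$ is the space of Lipschitz maps $f:\mathcal X\to\mathbb R^D$, with norm $\max\{|f|_{\mathrm{Lip}},\|f(\mathrm e)\|_2\}$, $|f|_{\mathrm{Lip}}=\sup_{x\ne y}\|f(x)-f(y)\|_2/\|x-y\|_2$. The Arens–Eells space $\mathrm{AE}(\mathcal X)$ is the completion of the span of $\{\delta_x-\delta_y:x,y\in\mathcal X\}$ under $\|m\|=\inf\{\sum_i|a_i|\,\|x_i-y_i\|_2: m=\sum_i a_i(\delta_{x_i}-\delta_{y_i})\}$; it is the predual of the scalar Lipschitz functions vanishing at $\mathrm e$, via $\langle\sum_i a_i(\delta_{x_i}-\delta_{y_i}),g\rangle=\sum_i a_i(g(x_i)-g(y_i))$. $\mathrm{Lip}(\mathcal X;\mathbb R^D)$ is isometrically the dual of $(\mathrm{AE}(\mathcal X)\widehat\otimes_\pi\mathbb R^D)\oplus_1\mathbb R^D$, and $w^*$ is the corresponding weak\* topology: the coarsest topology making $f\mapsto\langle m,f_j-f_j(\mathrm e)\rangle$ and $f\mapsto f_j(\mathrm e)$ continuous for all components $j$ and all $m\in \mathrm{AE}(\mathcal X)$. **Lower semicontinuous regularization.** A function $K$ on a topological space with values in $[-\infty,+\infty]$ is l.s.c. if all sublevel sets $\{K\le\alpha\}$, $\alpha\in\mathbb R$, are closed. Its l.s.c. regularization is the largest l.s.c. function bounded above by $K$. A function on a finite-dimensional space is coercive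 if its sublevel sets are bounded, and proper if it is finite somewhere (and never $-\infty$). **Deep ReLU networks.** $\Theta_L$ is the set of tuples $\theta=((W_1,b_1),\dots,(W_L,b_L))$ with $W_\ell\in\mathbb R^{K_{\ell+1}\times K_\ell}$, $b_\ell\in\mathbb R^{K_{\ell+1}}$, $K_1=d$, $K_{L+1}=D$, and arbitrary finite hidden widths $K_2,\dots,K_L\in\mathbb N$. Set $f_\theta=a_L\circ\sigma\circ a_{L-1}\circ\cdots\circ\sigma\circ a_1$ restricted to $\mathcal X$, $a_\ell(z)=W_\ell z+b_\ell$, $\sigma=\max\{0,\cdot\}$ entrywise. The parameter cost is $C_L(\theta)=\frac1L\sum_{\ell=1}^L\|W_\ell\|_F^2$. Define $R_{\Theta_L}(f)=\inf\{C_L(\theta):\theta\in\Theta_L,\ f_\theta=f\}$ for $f\in\mathrm{Lip}(\mathcal X;\mathbb R^D)$ ($\inf\varnothing=+\infty$). $R_L$ is the $w^*$-l.s.c. regularization of $R_{\Theta_L}$ on $\mathrm{Lip}(\mathcal X;\mathbb R^D)$. *)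

(* Defs.v *)
From HB Require Import structures.
From mathcomp Require Import all_boot all_order all_algebra.
From mathcomp Require Import all_classical all_reals all_analysis.
From mathcomp Require Import lra.

Set Implicit Arguments.
Unset Strict Implicit.
Unset Printing Implicit Defensive.

Import Order.TTheory GRing.Theory Num.Theory.
Import numFieldNormedType.Exports.

Local Open Scope classical_set_scope.
Local Open Scope ring_scope.

(* The norm that MathComp-Analysis puts on matrices is the sup norm, hence a
   separate definition of the Euclidean one. *)
Definition enorm (R : realType) n (v : 'cV[R]_n) : R :=
  Num.sqrt (\sum_(i < n) v i ord0 ^+ 2).

Definition frobenius (R : realType) m n (W : 'M[R]_(m, n)) : R :=
  Num.sqrt (\sum_(i < m) \sum_(j < n) W i j ^+ 2).

Record Lip (R : realType) (d : nat) (X : set 'cV[R]_d) (D : nat) := MkLip {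
  lip_fun :> X -> 'cV[R]_D ;
  lip_funP : exists C : R, forall x y : X,
    enorm (lip_fun x - lip_fun y) <= C * enorm (val x - val y) }.

HB.instance Definition _ (R : realType) d (X : set 'cV[R]_d) D :=
  gen_eqMixin (Lip X D).
HB.instance Definition _ (R : realType) d (X : set 'cV[R]_d) D :=
  gen_choiceMixin (Lip X D).

Section ArensEells.
Context {R : realType} {d : nat} {X : set 'cV[R]_d}.

(* The list of triples (a_i, x_i, y_i) is an expression of the molecule
   sum_i a_i (delta_(x_i) - delta_(y_i)); the molecule itself is
   [mol_fun s], and distinct expressions may denote the same molecule. *)
Definition mol_expr := seq (R * X * X).

Definition mol_fun (s : mol_expr) (z : X) : R :=
  \sum_(t <- s) t.1.1 * ((z == t.1.2)%:R - (z == t.2)%:R).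

Definition mol_cost (s : mol_expr) : R :=
  \sum_(t <- s) `|t.1.1| * enorm (val t.1.2 - val t.2).

Definition mol_norm (s : mol_expr) : R :=
  inf [set mol_cost t | t in [set t | mol_fun t = mol_fun s]].

Definition mol_sub (s t : mol_expr) : mol_expr :=
  s ++ [seq (- u.1.1, u.1.2, u.2) | u <- t].

Definition mol_pair (s : mol_expr) (g : X -> R) : R :=
  \sum_(t <- s) t.1.1 * (g t.1.2 - g t.2).

(* A point of the completion AE(X) is represented by a Cauchy sequence of
   molecules. Equivalent sequences are not identified: they have the same
   pairing with Lipschitz functions, so they induce the same functional. *)
Record AE := MkAE {
  ae_seq :> nat -> mol_expr ;
  ae_cauchy : forall eps : R, 0 < eps -> exists n0 : nat,
    forall m n : nat, (n0 <= m)%N -> (n0 <= n)%N ->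
      mol_norm (mol_sub (ae_seq m) (ae_seq n)) < eps }.

Definition ae_pair (m : AE) (g : X -> R) : R :=
  limn (fun n => mol_pair (m n) g).

Lemma mol_fun_sub (s t : mol_expr) :
  mol_fun (mol_sub s t) = (fun z => mol_fun s z - mol_fun t z).
Proof.
apply/funext => z; rewrite /mol_fun /mol_sub big_cat big_map /=; congr (_ + _).
by rewrite -sumrN; apply: eq_bigr => u _; rewrite mulNr.
Qed.

End ArensEells.
Arguments AE {R d} X.

Section WeakStar.
Context {R : realType} {d : nat} {X : set 'cV[R]_d}.

Definition wstar_functional (e : X) D (i : AE X * 'I_D + 'I_D) (f : Lip X D) : R :=
  match i with
  | inl (m, j) => ae_pair m (fun z => f z j ord0 - f e j ord0)
  | inr j => f e j ord0
  end.

Definition wstar (e : X) D : Type :=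
  sup_topology (fun i : AE X * 'I_D + 'I_D =>
    Topological.class (initial_topology (wstar_functional e i))).

HB.instance Definition _ (e : X) D := Topological.on (wstar e D).

End WeakStar.

Section LscRegularization.
Context {R : realType} {T : topologicalType}.
Implicit Types K H : T -> \bar R.
Local Open Scope ereal_scope.

Lemma lower_semicontinuous_closedP K :
  lower_semicontinuous K <-> forall a : R, closed [set t | K t <= a%:E].
Proof.
have E a : [set t | K t <= a%:E] = ~` [set t | a%:E < K t].
  by apply/seteqP; split=> t /=; rewrite leNgt => /negP.
rewrite lower_semicontinuousP; split=> h a; first by rewrite E; exact: open_closedC.
by rewrite -[X in open X]setCK -E; exact: closed_openC.
Qed.

Definition lsc_regularization K : T -> \bar R := fun t =>
  ereal_sup [set H t | H in
    [set H | lower_semicontinuous H /\ forall u, H u <= K u]].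

Lemma lsc_regularization_le K t : lsc_regularization K t <= K t.
Proof. by apply: ge_ereal_sup => _ [H [_ HK] <-]. Qed.

Lemma lsc_regularization_lsc K : lower_semicontinuous (lsc_regularization K).
Proof.
move=> t a /ereal_sup_gt[_ [H [Hlsc HK] <-] aH].
have [V tV VH] := Hlsc _ _ aH; exists V => // u /VH /lt_le_trans; apply.
by apply: ereal_sup_ubound; exists H.
Qed.

Lemma lsc_regularization_max K H : lower_semicontinuous H ->
  (forall t, H t <= K t) -> forall t, H t <= lsc_regularization K t.
Proof. by move=> Hlsc HK t; apply: ereal_sup_ubound; exists H. Qed.

End LscRegularization.

Section Networks.
Context {R : realType}.

Record layer (p q : nat) := Layer { weight : 'M[R]_(q, p) ; bias : 'cV[R]_q }.

Definition affine p q (a : layer p q) (z : 'cV[R]_p) : 'cV[R]_q :=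
  weight a *m z + bias a.

Definition relu n (z : 'cV[R]_n) : 'cV[R]_n := map_mx (Num.max 0) z.

(* [params D L d] is Theta_L for networks from R^d to R^D: the layers are
   listed from the input to the output, L is their number, and the hidden
   widths are positive. *)
Inductive params (D : nat) : nat -> nat -> Type :=
| OutputLayer p : layer p D -> params D 1 p
| HiddenLayer L p k : layer p k.+1 -> params D L k.+1 -> params D L.+1 p.

Fixpoint net_fun D L p (theta : params D L p) : 'cV[R]_p -> 'cV[R]_D :=
  match theta in params _ _ p return 'cV[R]_p -> 'cV[R]_D with
  | OutputLayer _ a => affine a
  | HiddenLayer _ _ _ a theta' => fun z => net_fun theta' (relu (affine a z))
  end.

Fixpoint sum_sq_weights D L p (theta : params D L p) : R :=
  match theta with
  | OutputLayer _ a => frobenius (weight a) ^+ 2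
  | HiddenLayer _ _ _ a theta' =>
      frobenius (weight a) ^+ 2 + sum_sq_weights theta'
  end.

Fixpoint hidden_widths D L p (theta : params D L p) : seq nat :=
  match theta with
  | OutputLayer _ _ => [::]
  | HiddenLayer _ _ k _ theta' => k.+1 :: hidden_widths theta'
  end.

Definition param_cost D L p (theta : params D L p) : R :=
  L%:R^-1 * sum_sq_weights theta.

Definition params_le D L p (K : nat) : set (params D L p) :=
  [set theta | all (fun k => (k <= K)%N) (hidden_widths theta)].

Lemma enorm_ge0 n (v : 'cV[R]_n) : 0 <= enorm v.
Proof. exact: sqrtr_ge0. Qed.

Lemma coord_le_enorm n (v : 'cV[R]_n) i : `|v i ord0| <= enorm v.
Proof.
rewrite -sqrtr_sqr ler_sqrt ?sumr_ge0// => [|j _]; last exact: sqr_ge0.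
by rewrite (bigD1 i)//= lerDl sumr_ge0// => j _; exact: sqr_ge0.
Qed.

Lemma enorm_le_sum n (v : 'cV[R]_n) : enorm v <= \sum_i `|v i ord0|.
Proof.
have s0 : 0 <= \sum_i `|v i ord0| by apply: sumr_ge0.
rewrite -(ger0_norm s0) -sqrtr_sqr ler_sqrt ?sqr_ge0// expr2 mulr_suml.
apply: ler_sum => i _; rewrite -real_normK ?num_real// expr2 ler_wpM2l//.
by rewrite (bigD1 i)//= lerDl sumr_ge0.
Qed.

Lemma affine_lipschitz p q (a : layer p q) : exists2 C : R, 0 <= C &
  forall y z, enorm (affine a y - affine a z) <= C * enorm (y - z).
Proof.
exists (\sum_i \sum_j `|weight a i j|).
  by apply: sumr_ge0 => i _; apply: sumr_ge0.
move=> y z; rewrite /affine opprD addrACA subrr addr0 -mulmxBr.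
apply: (le_trans (enorm_le_sum _)); rewrite mulr_suml; apply: ler_sum => i _.
rewrite mxE mulr_suml; apply: (le_trans (ler_norm_sum _ _ _)).
by apply: ler_sum => j _; rewrite normrM ler_wpM2l// coord_le_enorm.
Qed.

Lemma relu_lipschitz n (y z : 'cV[R]_n) : enorm (relu y - relu z) <= enorm (y - z).
Proof.
rewrite ler_sqrt ?sumr_ge0// => [|i _]; last exact: sqr_ge0.
apply: ler_sum => i _; rewrite !mxE -[leLHS]real_normK ?num_real//.
rewrite -[leRHS]real_normK ?num_real// ler_pXn2r ?nnegrE//.
rewrite !maxEle; case: (leP 0 (y i ord0)) => ?; case: (leP 0 (z i ord0)) => ?;
  case: (ger0P (y i ord0 - z i ord0)) => ?; by rewrite ?ler_norml; try (apply/andP; split); lra.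
Qed.

Lemma net_fun_lipschitz D L p (theta : params D L p) : exists2 C : R, 0 <= C &
  forall y z, enorm (net_fun theta y - net_fun theta z) <= C * enorm (y - z).
Proof.
elim: theta => [{}p a|{}L {}p k a theta [C C0 IH]] /=; first exact: affine_lipschitz.
have [B B0 HB] := affine_lipschitz a; exists (C * B); first exact: mulr_ge0.
move=> y z; apply: (le_trans (IH _ _)); rewrite -mulrA ler_wpM2l//.
exact: le_trans (relu_lipschitz _ _) (HB _ _).
Qed.

Lemma net_fun_lip_on d (X : set 'cV[R]_d) D L (theta : params D L d) :
  exists C : R, forall x y : X,
    enorm (net_fun theta (val x) - net_fun theta (val y)) <=
    C * enorm (val x - val y).
Proof.
by have [C _ HC] := net_fun_lipschitz theta; exists C => x y; exact: HC.
Qed.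

Definition realization d (X : set 'cV[R]_d) D L (theta : params D L d) : Lip X D :=
  MkLip (net_fun_lip_on X theta).

End Networks.
Arguments layer : clear implicits.
Arguments params : clear implicits.

Section RepresentationCost.
Context {R : realType} {d : nat} {X : set 'cV[R]_d} {D : nat}.
Local Open Scope ereal_scope.

Definition param_rep_cost (L : nat) (f : Lip X D) : \bar R :=
  ereal_inf [set (param_cost theta)%:E | theta in
    [set theta : params R D L d | realization X theta = f]].

Definition rep_cost (e : X) (L : nat) (f : Lip X D) : \bar R :=
  lsc_regularization (param_rep_cost L : wstar e D -> \bar R) f.

Definition finite_rep_cost (e : X) (L : nat) : set (Lip X D) :=
  [set f | rep_cost e L f < +oo].

(* (R^D)^N is identified with the D x N matrices, the j-th column being the
   j-th vector. *)
Definition sample N (x : 'I_N -> X) (f : Lip X D) : 'M[R]_(D, N) :=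
  \matrix_(i, j) f (x j) i ord0.

End RepresentationCost.

Definition proper_fun (R : realType) (T : Type) (G : T -> \bar R) : Prop :=
  (exists y, G y \is a fin_num) /\ forall y, G y != -oo%E.

Definition coercive (R : realType) D N (G : 'M[R]_(D, N) -> \bar R) : Prop :=
  forall a : R, bounded_set [set y | (G y <= a%:E)%E].

Definition argmin (R : realType) (T : Type) (A : set T) (J : T -> \bar R) : set T :=
  [set t | A t /\ forall u, A u -> (J t <= J u)%E].

(* Main.v *)
Require Import Defs.
From mathcomp Require Import all_boot all_order all_algebra.
From mathcomp Require Import all_classical all_reals all_analysis.
From mathcomp Require Import ring lra.

Set Implicit Arguments.
Unset Strict Implicit.
Unset Printing Implicit Defensive.

Import Order.TTheory GRing.Theory Num.Theory.
Import numFieldNormedType.Exports.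
Local Open Scope classical_set_scope.
Local Open Scope ring_scope.

(* Let phi(Y) be the least parameter cost of a network taking the values Y at
   the data points x_1, ..., x_N. Point evaluations are w*-continuous, so once
   phi is known to be l.s.c., phi(f(x_1), ..., f(x_N)) is a w*-l.s.c. minorant
   of R_(Theta_L), hence of R_L. It therefore suffices to minimize G + lambda phi
   over the finite-dimensional space of data values, and a network attaining
   this minimum solves (P); no w*-compactness is involved.

   Width N^2 is enough on the data. Let H be the matrix of the activations of a
   hidden layer, with rows h_k, and W the next weight matrix. Projecting the
   rows of W onto the column space of H keeps W H and does not increase the
   norm; then W = M H^T. If there are more than N^2 neurons, the matrices
   h_k^T h_k are dependent, sum_k l_k h_k^T h_k = 0, so giving neuron k the
   weight 1 - s l_k (by homogeneity of the ReLU) does not change W H; a suitable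
   s deletes a neuron without increasing the cost.

   With widths at most N^2, the set of triples (inputs, outputs, cost bound) that
   some network realizes is closed, by induction on the depth: the weights are
   bounded by the cost, and the unpenalized biases can be clamped on bounded
   data. This gives both the lower semicontinuity of phi and the existence of
   the minimum. *)

(** * Deleting neurons of a wide hidden layer *)

Lemma frobenius_sqr (R : realType) m n (W : 'M[R]_(m, n)) :
  frobenius W ^+ 2 = \sum_(i < m) \sum_(j < n) W i j ^+ 2.
Proof.
by rewrite sqr_sqrtr// sumr_ge0// => i _; apply: sumr_ge0 => j _; exact: sqr_ge0.
Qed.

Lemma frobenius_sqr_trace (R : realType) m n (W : 'M[R]_(m, n)) :
  frobenius W ^+ 2 = \tr (W *m W^T).
Proof.
rewrite frobenius_sqr; apply: eq_bigr => i _; rewrite mxE; apply: eq_bigr => j _.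
by rewrite mxE expr2.
Qed.

Lemma trmx_mul_eq0 (R : realType) m n (A : 'M[R]_(m, n)) : A^T *m A = 0 -> A = 0.
Proof.
move=> A0; have : frobenius A^T ^+ 2 = 0.
  by rewrite frobenius_sqr_trace trmxK A0 mxtrace0.
rewrite frobenius_sqr => /psumr_eq0P S0; apply/matrixP => i j; rewrite [RHS]mxE.
have /psumr_eq0P Sj : \sum_(i < m) A^T j i ^+ 2 = 0.
  by apply: S0 => // j' _; apply: sumr_ge0 => i' _; exact: sqr_ge0.
have /eqP := Sj (fun i _ => sqr_ge0 _) i isT.
by rewrite sqrf_eq0 mxE => /eqP.
Qed.

(** If [C] spans the kernel of [H^T *m H], then [(H C)^T (H C) = 0], so [H C = 0]: over the reals a
    Gram matrix loses no rank. *)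
Lemma submx_gram (R : realType) k N (H : 'M[R]_(k, N)) : (H <= H^T *m H)%MS.
Proof.
rewrite submxE; apply/eqP/trmx_mul_eq0.
by rewrite trmx_mul -!mulmxA (mulmxA H^T) mulmx_coker mulmx0.
Qed.

(* Orthogonal projection of the rows of [W] onto the column space of [H]. *)
Lemma gram_factor (R : realType) q k N (W : 'M[R]_(q, k)) (H : 'M[R]_(k, N)) :
  exists2 M : 'M[R]_(q, N), M *m H^T *m H = W *m H &
    frobenius (M *m H^T) ^+ 2 <= frobenius W ^+ 2.
Proof.
have /submxP[M WH] := submx_trans (submxMl W H) (submx_gram H).
exists M; first by rewrite WH mulmxA.
set V := W - M *m H^T.
have VH : V *m H = 0 by rewrite mulmxBl WH mulmxA subrr.
have -> : W = V + M *m H^T by rewrite subrK.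
have tV : \tr (V *m (M *m H^T)^T) = 0.
  by rewrite trmx_mul trmxK mulmxA VH mul0mx mxtrace0.
have tVT : \tr (M *m H^T *m V^T) = 0.
  by rewrite -mxtrace_tr trmx_mul trmxK.
rewrite [leRHS]frobenius_sqr_trace linearD/= mulmxDl !mulmxDr !mxtraceD tV tVT.
by rewrite -!frobenius_sqr_trace addr0 add0r lerDr sqr_ge0.
Qed.

(** The flattened matrices [h_i^T h_i] are [k] vectors in dimension [N * N]; a nonzero left kernel
    vector of the matrix stacking them gives the coefficients. *)
Lemma gram_dependency (R : realType) k N (H : 'M[R]_(k, N)) : (N * N < k)%N ->
  exists2 l : 'rV[R]_k, l != 0 & H^T *m diag_mx l *m H = 0.
Proof.
move=> Nk; pose B : 'M[R]_(k, N * N) := \matrix_i mxvec ((row i H)^T *m row i H).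
have : kermx B != 0.
  by rewrite -mxrank_eq0 mxrank_ker -lt0n subn_gt0 (leq_ltn_trans (rank_leq_col B)).
case/rowV0Pn => l /sub_kermxP lB l0; exists l => //.
apply: (can_inj mxvecK); rewrite linear0 -lB mulmx_sum_row.
have -> : H^T *m diag_mx l *m H = \sum_i l 0 i *: ((row i H)^T *m row i H).
  apply/matrixP => a b; rewrite !mxE summxE; apply: eq_bigr => i _.
  rewrite mul_mx_diag !mxE big_ord1 !mxE; ring.
by rewrite linear_sum; apply: eq_bigr => i _; rewrite linearZ/= rowK.
Qed.

(* One step of the conic Caratheodory argument: move from the weights 1 along
   [l] until the first weight vanishes, in the direction of lower cost. *)
Lemma caratheodory_step (R : realType) k (l c : 'I_k -> R) :
  (forall i, 0 <= c i) -> (exists i, l i != 0) ->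
  exists s, exists2 i0, 1 - s * l i0 = 0 &
    (forall i, 0 <= 1 - s * l i) /\ \sum_i (1 - s * l i) * c i <= \sum_i c i.
Proof.
move=> c0.
have step (u : 'I_k -> R) i : 0 < u i -> 0 <= \sum_i u i * c i ->
    exists s, exists2 i0, 1 - s * u i0 = 0 &
    (forall i, 0 <= 1 - s * u i) /\ \sum_i (1 - s * u i) * c i <= \sum_i c i.
  move=> ui uc; case: (@Order.TotalTheory.arg_maxP _ _ _ i xpredT u isT) => i0 _ u_max.
  have ui0 : 0 < u i0 by apply: lt_le_trans (u_max i isT).
  (* With [u i0] the largest entry, [s = 1 / u i0] is the first parameter at which some weight
     vanishes. *)
  exists (u i0)^-1, i0; first by rewrite mulVf ?subrr// gt_eqF.
  split=> [j|]; first by rewrite subr_ge0 mulrC ler_pdivrMr// mul1r; exact: u_max.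
  under eq_bigr do rewrite mulrBl mul1r -mulrA.
  rewrite sumrB -mulr_sumr gerBl; apply: mulr_ge0 => //.
  by rewrite invr_ge0 ltW.
have stepN (u : 'I_k -> R) i : u i < 0 -> \sum_i u i * c i <= 0 ->
    exists s, exists2 i0, 1 - s * u i0 = 0 &
    (forall i, 0 <= 1 - s * u i) /\ \sum_i (1 - s * u i) * c i <= \sum_i c i.
  move=> ui uc; have [| |s [i0 s0 [s1 s2]]] := step (fun i => - u i) i.
  - by rewrite oppr_gt0.
  - by under eq_bigr do rewrite mulNr; rewrite sumrN oppr_ge0.
  exists (- s), i0; first by rewrite mulNr -mulrN.
  split=> [j|]; first by rewrite mulNr -mulrN.
  by under eq_bigr do rewrite mulNr -mulrN.
case=> i li.
have [[j lj]|npos] := pselect (exists j, 0 < l j); last first.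
  have lle j : l j <= 0 by rewrite leNgt; apply/negP => lj; apply: npos; exists j.
  apply: (stepN l i); first by rewrite lt_neqAle li lle.
  by apply: sumr_le0 => j _; rewrite mulr_le0_ge0.
have [lc|lc] := leP 0 (\sum_i l i * c i); first exact: step lj lc.
(* The cost slope is negative and [c] is nonnegative, so some entry of [l] is negative and moving in
   the opposite direction works. *)
have [[m lm]|nneg] := pselect (exists m, l m < 0); first exact: stepN lm (ltW lc).
have lge m : 0 <= l m by rewrite leNgt; apply/negP => lm; apply: nneg; exists m.
by move: lc; rewrite ltNge sumr_ge0// => m _; rewrite mulr_ge0.
Qed.

Lemma drop_neuron (R : realType) p q k N (a : layer R p k.+1)
    (W : 'M[R]_(q, k.+1)) (Z : 'M[R]_(p, N)) : (N * N < k.+1)%N ->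
  exists (a' : layer R p k) (W' : 'M[R]_(q, k)),
    (forall j, W' *m relu (affine a' (col j Z)) = W *m relu (affine a (col j Z)))
    /\ frobenius (weight a') ^+ 2 + frobenius W' ^+ 2 <=
       frobenius (weight a) ^+ 2 + frobenius W ^+ 2.
Proof.
move=> Nk; pose H := \matrix_(i < k.+1, j < N) relu (affine a (col j Z)) i 0.
have colH j : relu (affine a (col j Z)) = col j H.
  by apply/matrixP => i i'; rewrite [i']ord1 [RHS]mxE [RHS]mxE.
have [M MH MW] := gram_factor W H.
have [l l0 lH] := gram_dependency H Nk.
set V := M *m H^T in MH MW.
(* The cost carried by neuron [i]: its incoming weights and its outgoing ones. *)
pose c i := \sum_j weight a i j ^+ 2 + \sum_j V j i ^+ 2.
have [||s [i0 si0 [s_ge0 s_cost]]] := @caratheodory_step R _ (l 0) c.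
- by move=> i; apply: addr_ge0; apply: sumr_ge0 => j _; exact: sqr_ge0.
- apply: contrapT => lz; case/negP: l0; apply/eqP/matrixP => i j; rewrite [i]ord1 mxE.
  by apply: contrapT => /eqP lj; apply: lz; exists j.
(* The new weight of a neuron is split evenly: a factor [r i] on its input side, bias included, and
   one on its output side. Each squared norm is then multiplied by exactly [1 - s * l 0 i]. *)
pose r i := Num.sqrt (1 - s * l 0 i).
have rr i : r i * r i = 1 - s * l 0 i by rewrite -expr2 sqr_sqrtr.
have ri0 : r i0 = 0 by rewrite /r si0 sqrtr0.
pose f := lift i0.
exists (Layer (\matrix_(i, j) (r (f i) * weight a (f i) j))
              (\col_i (r (f i) * bias a (f i) 0))).
exists (\matrix_(j, i) (r (f i) * V j (f i))); split=> [j|].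
  (* Since [V = M H^T] and [H^T diag(l) H = 0], reweighting the neurons leaves [V H = W H]
     unchanged. *)
  have -> : W *m relu (affine a (col j Z)) = V *m (1%:M - s *: diag_mx l) *m col j H.
    rewrite mulmxBr mulmx1 mulmxBl colH colE !mulmxA MH -scalemxAr -!scalemxAl.
    by rewrite /V -(mulmxA M) -(mulmxA M) lH mulmx0 mul0mx scaler0 subr0.
  have VD y i : (V *m (1%:M - s *: diag_mx l)) y i = V y i * (r i * r i).
    rewrite mxE (bigD1 i)//= big1 ?addr0 => [|i' /negPf ii'].
      by rewrite !mxE eqxx !mulr1n rr.
    by rewrite !mxE ii' !mulr0n mulr0 subrr mulr0.
  apply/matrixP => y u; rewrite [u]ord1 mxE [RHS]mxE (bigD1_ord i0)//=.
  rewrite VD ri0 mul0r mulr0 mul0r add0r.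
  apply: eq_bigr => i _; rewrite VD [X in X * _]mxE -colH.
  rewrite [relu _ i 0]mxE [relu _ (lift i0 i) 0]mxE.
  have -> : affine (Layer (\matrix_(i, j) (r (f i) * weight a (f i) j))
      (\col_i (r (f i) * bias a (f i) 0))) (col j Z) i 0 =
      r (f i) * affine a (col j Z) (f i) 0.
    rewrite !mxE mulrDr mulr_sumr; congr (_ + _); apply: eq_bigr => i' _.
    by rewrite !mxE mulrA.
  set v := affine a _ _ _.
  have -> : Num.max 0 (r (f i) * v) = r (f i) * Num.max 0 v.
    by rewrite maxr_pMr ?sqrtr_ge0// mulr0.
  rewrite /f; ring.
apply: le_trans (_ : frobenius (weight a) ^+ 2 + frobenius V ^+ 2 <= _); last first.
  by rewrite lerD2l.
have costE m n o (A : 'M[R]_(m, n)) (B : 'M[R]_(o, m)) :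
    frobenius A ^+ 2 + frobenius B ^+ 2 =
    \sum_i (\sum_j A i j ^+ 2 + \sum_j B j i ^+ 2).
  by rewrite !frobenius_sqr big_split/=; congr (_ + _); exact: exchange_big.
rewrite !costE; apply: le_trans s_cost.
rewrite [leRHS](bigD1_ord i0)//= si0 mul0r add0r; apply: ler_sum => i _.
rewrite mulrDr !mulr_sumr lerD//; apply: ler_sum => j _; rewrite mxE exprMn.
  by rewrite -rr expr2.
by rewrite -rr expr2.
Qed.

(** Isolates the first layer, hidden or output alike, so that it can be exchanged, even for another
    input dimension, while the rest of the network stays as [F] with cost [c]. *)
Lemma replace_first_layer (R : realType) D L p (theta : params R D L p) :
  exists q (a : layer R p q) (F : 'cV[R]_q -> 'cV[R]_D) (c : R),
    [/\ forall z, net_fun theta z = F (affine a z),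
        sum_sq_weights theta = frobenius (weight a) ^+ 2 + c
      & forall p' (a' : layer R p' q), exists theta' : params R D L p',
          [/\ forall z, net_fun theta' z = F (affine a' z),
              sum_sq_weights theta' = frobenius (weight a') ^+ 2 + c
            & hidden_widths theta' = hidden_widths theta]].
Proof.
case: theta => [{}p a|{}L {}p k a theta].
  exists D, a, id, 0; split=> // [|p' a']; first by rewrite addr0.
  by exists (OutputLayer a'); split; rewrite ?addr0.
exists k.+1, a, (fun z => net_fun theta (relu z)), (sum_sq_weights theta).
by split=> // p' a'; exists (HiddenLayer a' theta).
Qed.

(** The shift is absorbed by the first bias, which is not penalized. *)
Lemma translate_input (R : realType) D L p (theta : params R D L p) (s : 'cV[R]_p) :
  exists theta' : params R D L p,
    [/\ forall z, net_fun theta' z = net_fun theta (z + s),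
        sum_sq_weights theta' = sum_sq_weights theta
      & hidden_widths theta' = hidden_widths theta].
Proof.
have [q [a [F [c [Fa ca repl]]]]] := replace_first_layer theta.
have [theta' [F' c' w']] := repl p (Layer (weight a) (weight a *m s + bias a)).
exists theta'; split=> // [z|]; last by rewrite c' ca.
by rewrite F' Fa /affine /= mulmxDr addrA.
Qed.

(** Neurons are deleted one at a time, by induction on the width; each deletion changes only this
    layer and the weights of the next one. *)
Lemma narrow_hidden_layer (R : realType) D L p k N n (a : layer R p k.+1)
    (theta : params R D L k.+1) (Z : 'M[R]_(p, N)) :
  (0 < n)%N -> (N * N <= n)%N -> exists (theta' : params R D L.+1 p) m,
    [/\ forall j, net_fun theta' (col j Z) = net_fun theta (relu (affine a (col j Z))),
        sum_sq_weights theta' <= frobenius (weight a) ^+ 2 + sum_sq_weights theta,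
        hidden_widths theta' = m :: hidden_widths theta & (m <= n)%N].
Proof.
move=> n0 Nn; elim: k a theta => [|k IH] a theta.
  by exists (HiddenLayer a theta), 1%N; split.
have [kn|nk] := leqP k.+2 n; first by exists (HiddenLayer a theta), k.+2.
have [q [a1 [F [c [Fa ca repl]]]]] := replace_first_layer theta.
have [a' [W' [W'E W'c]]] := drop_neuron a (weight a1) Z (leq_ltn_trans Nn nk).
have [theta1 [F1 c1 w1]] := repl k.+1 (Layer W' (bias a1)).
have [theta' [m [th1 th2 th3 mn]]] := IH a' theta1.
exists theta', m; split=> // [j||]; last by rewrite th3 w1.
  by rewrite th1 F1 Fa /affine /= W'E.
by apply: (le_trans th2); rewrite c1 ca !addrA lerD2r.
Qed.

Lemma narrow_network (R : realType) D L p N n (theta : params R D L p) (Z : 'M[R]_(p, N)) :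
  (0 < n)%N -> (N * N <= n)%N -> exists theta' : params R D L p,
    [/\ params_le n theta',
        forall j, net_fun theta' (col j Z) = net_fun theta (col j Z)
      & sum_sq_weights theta' <= sum_sq_weights theta].
Proof.
move=> n0 Nn; elim: theta Z => [{}p a|{}L {}p k a theta IH] Z.
  by exists (OutputLayer a).
(* The later layers are narrowed first, on the activations of the first hidden layer as data;
   narrowing that layer afterwards keeps their widths. *)
have [theta1 [n1 net1 c1]] := IH (\matrix_(i, j) relu (affine a (col j Z)) i 0).
have [theta' [m [net' c' w' mn]]] := narrow_hidden_layer a theta1 Z n0 Nn.
exists theta'; split=> [|j|]; first by rewrite /params_le /= w' /= mn.
  rewrite net' /=.
  have := net1 j; rewrite (_ : col j _ = relu (affine a (col j Z)))//.
  by apply/matrixP => i i'; rewrite [i']ord1 mxE mxE.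
by apply: (le_trans c'); rewrite lerD2l.
Qed.

Lemma params_inhabited (R : realType) D L p n : (0 < L)%N -> (0 < n)%N ->
  exists theta : params R D L p, params_le n theta.
Proof.
move=> L0 n0; elim: L p L0 => // -[_ p _|L IH p _].
  by exists (OutputLayer (Layer 0 0)).
have [theta th] := IH 1%N isT.
by exists (HiddenLayer (Layer 0 0) theta); rewrite /params_le /= n0.
Qed.

(** * Closedness of the set of realizable data *)

(** A tube-lemma argument: projecting along a compact factor preserves closedness. A witness may be
    replaced by another one in [K], which is what allows unbounded biases to be clamped. *)
Lemma closed_exists_locally_bounded (T W : topologicalType) (C : set (T * W)) :
  closed C ->
  (forall t : T, exists2 K : set W, compact K &
    \forall u \near t, forall w, C (u, w) -> exists2 w', K w' & C (u, w')) ->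
  closed [set t | exists w, C (t, w)].
Proof.
move=> Ccl Cbd t tcl; apply: contrapT => nCt; have [K Kc Kt] := Cbd t.
(* If no [w] works at [t], compactness gives one neighbourhood of [t] on which no [w] in [K]
   works. *)
have : \forall u \near t, K `<=` (fun w => ~ C (u, w)).
  apply: (compact_near_coveringP K).1 => // w _.
  have : nbhs (t, w) (~` C).
    apply: open_nbhs_nbhs; split; first exact: closed_openC.
    by move=> Ctw; apply: nCt; exists w.
  case=> -[/= A B] [tA wB] AB; exists (B, A) => //= -[w' u] [/= Bw Au].
  exact: (AB (u, w')).
move=> nearC; have [u [[w Cuw] [uK unC]]] := tcl _ (filterI Kt nearC).
by have [w' Kw' Cw'] := uK _ Cuw; exact: unC Cw'.
Qed.

Lemma continuous_mx (R : realType) (T : topologicalType) m n (f : T -> 'M[R]_(m, n)) :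
  (forall i j, continuous (fun t => f t i j)) -> continuous f.
Proof.
move=> fc t; apply/cvg_ballP => e e0.
have near_all : \forall u \near t, forall ij : 'I_m * 'I_n,
    ball (f t ij.1 ij.2) e (f u ij.1 ij.2).
  apply: filter_forall => -[i j] /=; exact: (cvg_ball (fc i j t)).
by apply: filterS near_all => u near_u; split=> // i j; exact: near_u (i, j).
Qed.

Lemma compact_mx_box (R : realType) m n (B : R) :
  compact [set A : 'M[R]_(m, n) | forall i j, `|A i j| <= B].
Proof.
have := @rV_compact R (m * n) (fun=> `[- B, B]%classic) (fun=> @segment_compact _ _ _).
move=> /(@continuous_compact _ _ (vec_mx : 'rV[R]_(m * n) -> 'M[R]_(m, n))) h.
rewrite (_ : [set _ | _] = vec_mx @`
    [set v : 'rV[R]_(m * n) | forall i, `[- B, B]%classic (v 0 i)]).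
  apply: h; apply: continuous_subspaceT; apply: continuous_mx => i j.
  under eq_fun do rewrite mxE.
  exact: coord_continuous.
apply/seteqP; split=> [A Ab|_ [v vb <-] i j].
  exists (mxvec A); last exact: mxvecK.
  by move=> i; case/mxvec_indexP: i => i j /=; rewrite mxvecE in_itv/= -ler_norml.
by rewrite mxE ler_norml; have := vb (mxvec_index i j); rewrite /= in_itv.
Qed.

Lemma continuous_pair (T U V : topologicalType) (f : T -> U) (g : T -> V) :
  continuous f -> continuous g -> continuous (fun t => (f t, g t)).
Proof. by move=> fc gc t; exact: (cvg_pair (fc t) (gc t)). Qed.

Lemma continuous_sum (R : realType) (T : topologicalType) m (f : 'I_m -> T -> R) :
  (forall i, continuous (f i)) -> continuous (fun t => \sum_i f i t).
Proof.
move=> fc t; apply: cvg_big => [|i _]; last exact: fc.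
exact: add_continuous.
Qed.

Section ContinuousMatrixMaps.
Context {R : realType} {T : topologicalType}.

Lemma continuous_entry m n (f : T -> 'M[R]_(m, n)) i j :
  continuous f -> continuous (fun t => f t i j).
Proof. by move=> fc t; apply: continuous_comp (fc t) (@coord_continuous _ _ _ i j _). Qed.

Lemma continuous_mulmx m n p (A : T -> 'M[R]_(m, n)) (B : T -> 'M[R]_(n, p)) :
  continuous A -> continuous B -> continuous (fun t => A t *m B t).
Proof.
move=> Ac Bc; apply: continuous_mx => i j; under eq_fun do rewrite mxE.
apply: continuous_sum => k t; apply: continuousM; exact: continuous_entry.
Qed.

Lemma continuous_frobenius_sqr m n (A : T -> 'M[R]_(m, n)) :
  continuous A -> continuous (fun t => frobenius (A t) ^+ 2).
Proof.
move=> Ac; under eq_fun do rewrite frobenius_sqr.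
apply: continuous_sum => i; apply: continuous_sum => j t.
under eq_fun do rewrite expr2.
by apply: continuousM; exact: continuous_entry.
Qed.

End ContinuousMatrixMaps.

(** The layer is a pair of matrices so that the product topology is available for it. *)
Definition hidden_data (R : realType) p q N (a : 'M[R]_(q, p) * 'cV[R]_q)
    (Z : 'M[R]_(p, N)) : 'M[R]_(q, N) :=
  \matrix_(i, j) relu (affine (Layer a.1 a.2) (col j Z)) i 0.

Lemma hidden_data_continuous (R : realType) p q N (T : topologicalType)
  (a : T -> 'M[R]_(q, p) * 'cV[R]_q) (Z : T -> 'M[R]_(p, N)) :
  continuous a -> continuous Z -> continuous (fun t => hidden_data (a t) (Z t)).
Proof.
move=> ac Zc; apply: continuous_mx => i j.
have E t : hidden_data (a t) (Z t) i j = Num.max 0 (((a t).1 *m Z t) i j + (a t).2 i 0).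
  by rewrite !mxE; congr (Num.max 0 (_ + _)); apply: eq_bigr => k _; rewrite !mxE.
under eq_fun do rewrite E.
apply: (@max_fun_continuous _ T R (fun=> 0)); first by move=> t; exact: cvg_cst.
have a1c : continuous (fun t => (a t).1).
  by move=> s; apply: (continuous_comp (ac s)); exact: cvg_fst.
have a2c : continuous (fun t => (a t).2).
  by move=> s; apply: (continuous_comp (ac s)); exact: cvg_snd.
move=> t; apply: continuousD; last exact: continuous_entry.
by apply: continuous_entry => //; exact: continuous_mulmx.
Qed.

Lemma frobenius_sqr_entry (R : realType) m n (W : 'M[R]_(m, n)) i j :
  `|W i j| <= 1 + frobenius W ^+ 2.
Proof.
apply: (@le_trans _ _ (1 + W i j ^+ 2)); first last.
  rewrite lerD2l frobenius_sqr (bigD1 i)//= (bigD1 j)//= -addrA lerDl.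
  apply: addr_ge0; first by apply: sumr_ge0 => ? _; exact: sqr_ge0.
  by apply: sumr_ge0 => ? _; apply: sumr_ge0 => ? _; exact: sqr_ge0.
rewrite -real_normK ?num_real//; have := sqr_ge0 (`|W i j| - 1); have := normr_ge0 (W i j).
by set x := `|_|; nra.
Qed.

Lemma mulmx_col_entry (R : realType) q p N (W : 'M[R]_(q, p)) (Z : 'M[R]_(p, N)) i j o :
  (W *m col j Z) i o = (W *m Z) i j.
Proof. by rewrite !mxE; apply: eq_bigr => k _; rewrite !mxE. Qed.

Lemma sum_sq_weights_ge0 (R : realType) D L p (theta : params R D L p) :
  0 <= sum_sq_weights theta.
Proof. by elim: theta => * /=; rewrite ?addr_ge0 ?sqr_ge0. Qed.

(* Beyond the bound [B] a neuron is inactive on all the data, or active on all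
   of them; in the latter case its excess bias can be passed on to the next
   layer. *)
Lemma clamp_bias (R : realType) p q N (w : 'M[R]_(q, p) * 'cV[R]_q)
    (Z : 'M[R]_(p, N)) (B : R) : 0 <= B -> (forall i j, `|(w.1 *m Z) i j| <= B) ->
  exists (b : 'cV[R]_q) (s : 'cV[R]_q), (forall i, `|b i 0| <= B) /\
    forall j, col j (hidden_data w Z) = col j (hidden_data (w.1, b) Z) + s.
Proof.
case: w => W b /= B0 WZ.
exists (\col_i Num.max (- B) (Num.min B (b i 0))), (\col_i Num.max 0 (b i 0 - B)).
have E v j i o : col j (hidden_data (W, v) Z) i o = Num.max 0 ((W *m Z) i j + v i 0).
  by rewrite !mxE; congr (Num.max 0 (_ + _)); apply: eq_bigr => k _; rewrite !mxE.
split=> [i|j].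
  rewrite mxE ler_norml le_max lexx ge_max ge_min lexx /= andbT; lra.
apply/matrixP => i o; rewrite [RHS]mxE !E !mxE; have := WZ i j; rewrite mxE ler_norml.
move: (b i 0) (\sum_(k < p) W i k * Z k j) => v u /andP[u1 u2].
have [Bv|vB] := leP B v.
  rewrite (max_r (_ : - B <= B)); last lra.
  by rewrite !max_r; lra.
rewrite (max_l (_ : v - B <= 0)) ?addr0; last lra.
have [Nv|vN] := leP (- B) v; first by [].
by rewrite !max_l; lra.
Qed.

(** * Data fitted by networks of bounded width and cost *)

Section FittingData.
Context {R : realType} {D N : nat}.

(** The last component bounds the cost from above, so this is an epigraph and can be closed. The
    inputs vary too, since the induction on depth feeds activations to the remaining layers. *)
Definition fits L p n : set ('M[R]_(p, N) * 'M[R]_(D, N) * R) :=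
  [set t | exists theta : params R D L p,
    [/\ params_le n theta, forall j, net_fun theta (col j t.1.1) = col j t.1.2
      & sum_sq_weights theta <= t.2]].

Definition fits_output p : set ('M[R]_(p, N) * 'M[R]_(D, N) * R) :=
  [set t | exists a : layer R p D,
    (forall j, affine a (col j t.1.1) = col j t.1.2) /\ frobenius (weight a) ^+ 2 <= t.2].

(** Peels off the first layer. A hidden layer has width [k.+1] with [k < n], so the union is
    finite. *)
Lemma fitsS L p n : @fits L.+1 p n =
  (if L == 0 then @fits_output p else set0) `|`
  \bigcup_(k in `I_n) [set t | exists w : 'M[R]_(k.+1, p) * 'cV[R]_k.+1,
     @fits L k.+1 n (hidden_data w t.1.1, t.1.2, t.2 - frobenius w.1 ^+ 2)].
Proof.
have colH p' q (W : 'M[R]_(q, p')) b (Z : 'M[R]_(p', N)) j :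
    col j (hidden_data (W, b) Z) = relu (affine (Layer W b) (col j Z)).
  by apply/matrixP => i i'; rewrite [i']ord1 mxE mxE.
apply/seteqP; split=> [t [theta]|t].
  (* The depth is generalized to a variable to permit case analysis on the indexed type. *)
  suff H L' (th : params R D L' p) : L' = L.+1 -> params_le n th ->
    (forall j, net_fun th (col j t.1.1) = col j t.1.2) -> sum_sq_weights th <= t.2 ->
    ((if L == 0 then @fits_output p else set0) `|`
  \bigcup_(k in `I_n) [set t | exists w : 'M[R]_(k.+1, p) * 'cV[R]_k.+1,
     @fits L k.+1 n (hidden_data w t.1.1, t.1.2, t.2 - frobenius w.1 ^+ 2)]) t.
    by case=> n_th net_th cost_th; exact: (H _ theta erefl n_th net_th cost_th).
  clear theta; case: th t => [{}p a|{}L' {}p k [W b] theta] t.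
    by move=> [<-] _ net_a cost_a; left; exists a.
  move=> [<-]; rewrite /params_le /= => /andP[kn th_n] net_th cost_th.
  right; exists k => //; exists (W, b), theta; split=> //= [j|].
    by rewrite colH net_th.
  by rewrite lerBrDl.
case=> [|[k kn [[W b] [theta [th_n net_th cost_th]]]]].
  case: eqP => // -> [a [net_a cost_a]]; by exists (OutputLayer a).
exists (HiddenLayer (Layer W b) theta); split=> [|j|] /=.
- by rewrite /params_le /= th_n andbT.
- by rewrite -colH net_th.
- by rewrite -lerBrDl.
Qed.

Lemma fits_translate L p n Z (s : 'cV[R]_p) Z' Y c :
  (forall j, col j Z = col j Z' + s) -> @fits L p n (Z, Y, c) -> @fits L p n (Z', Y, c).
Proof.
move=> ZZ' [theta [/= th_n net_th cost_th]].
have [theta' [net' cost' w']] := translate_input theta s.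
exists theta'; split=> /= [|j|]; first by rewrite /params_le /= w'.
  by rewrite net' -ZZ'.
by rewrite cost'.
Qed.

Local Notation data p := ('M[R]_(p, N) * 'M[R]_(D, N) * R)%type.

Lemma data_continuous p (T : topologicalType) :
  [/\ continuous (fun t : data p * T => t.1.1.1),
      continuous (fun t : data p * T => t.1.1.2),
      continuous (fun t : data p * T => t.1.2)
    & continuous (fun t : data p * T => t.2)].
Proof.
have c1 : continuous (fun t : data p * T => t.1) by move=> t; exact: cvg_fst.
have c11 : continuous (fun t : data p * T => t.1.1).
  by move=> t; apply: (continuous_comp (c1 t)); exact: cvg_fst.
split=> t.
- by apply: (continuous_comp (c11 t)); exact: cvg_fst.
- by apply: (continuous_comp (c11 t)); exact: cvg_snd.
- by apply: (continuous_comp (c1 t)); exact: cvg_snd.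
- exact: cvg_snd.
Qed.

Lemma near_data_bounded p (t : data p) :
  \forall u \near t, frobenius u.1.1 ^+ 2 <= frobenius t.1.1 ^+ 2 + 1 /\ u.2 <= t.2 + 1.
Proof.
have c2 : continuous (snd : data p -> R) by move=> u; exact: cvg_snd.
have c11 : continuous (fun u : data p => u.1.1).
  by move=> u; apply: (continuous_comp (@cvg_fst _ _ _ _ _)); exact: cvg_fst.
have := continuous_frobenius_sqr c11 => /(_ t) cF.
near=> u; split.
  by near: u; apply: (cvgr_le _ cF); rewrite ltrDl.
by near: u; apply: (cvgr_le _ (c2 t)); rewrite ltrDl.
Unshelve. all: by end_near. Qed.

(* The bias is determined by [W] and the value at [j0], so only [W], which the
   cost bounds, is quantified over. *)
Lemma closed_fits_output p : 'I_N -> closed (@fits_output p).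
Proof.
move=> j0.
(* The vanishing of all [f ij] says that the columns of [W Z - Y] coincide, so that a single bias
   corrects them. *)
pose f ij (t : data p * 'M[R]_(D, p)) := (t.2 *m t.1.1.1 - t.1.1.2) ij.1 ij.2 -
  (t.2 *m t.1.1.1 - t.1.1.2) ij.1 j0.
pose C := \bigcap_(ij in setT) f ij @^-1` [set x | x = 0] `&`
  (fun t => frobenius t.2 ^+ 2 - t.1.2) @^-1` [set x | x <= 0].
have subE (A B : 'M[R]_(D, N)) a b : (A - B) a b = A a b - B a b by rewrite !mxE.
rewrite (_ : @fits_output p = [set t | exists W, C (t, W)]); last first.
  apply/seteqP; split=> t /=.
    case=> -[W b] /= [net_a cost_a]; exists W; split=> /=; last by rewrite subr_le0.
    have E i j : (W *m t.1.1) i j - t.1.2 i j = - b i 0.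
      have /matrixP/(_ i 0) := net_a j.
      rewrite mxE mulmx_col_entry [RHS]mxE /= => <-; ring.
    move=> -[i j] _; rewrite /f /=.
    by rewrite !subE !E subrr.
  case=> W [] /= HC; rewrite subr_le0 => cost_W.
  exists (Layer W (col j0 (t.1.2 - W *m t.1.1))); split=> // j.
  apply/matrixP => i z; have /eqP := HC (i, j) I; rewrite subr_eq0 => /eqP /=.
  rewrite [z]ord1 !subE => fij.
  rewrite mxE mulmx_col_entry /= [col j0 _ i 0]mxE [RHS]mxE subE; lra.
have [cZ cY cc cW] := data_continuous p ('M[R]_(D, p) : topologicalType).
apply: closed_exists_locally_bounded => [|t].
  apply: closedI; last first.
    apply: preimage_closed (@closed_le R 0) => t _.
    apply: cvgB; last exact: cc.
    exact: continuous_frobenius_sqr.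
  apply: closed_bigI => ij _; apply: preimage_closed (@closed_eq R 0) => t _.
  have cM : continuous (fun t : data p * 'M[R]_(D, p) => t.2 *m t.1.1.1 - t.1.1.2).
    by move=> u; apply: cvgB; [exact: continuous_mulmx|exact: cY].
  by apply: cvgB; exact: (continuous_entry cM).
(* An entry is at most 1 plus the squared norm, itself at most [t.2 + 1] near [t]. *)
exists [set W : 'M[R]_(D, p) | forall i j, `|W i j| <= t.2 + 2]; first exact: compact_mx_box.
apply: filterS (near_data_bounded t) => u [_ u2] W CW; exists W => //= i j.
apply: le_trans (frobenius_sqr_entry W i j) _.
by case: CW => _ /=; rewrite subr_le0; lra.
Qed.

Lemma closed_fits L p n : 'I_N -> closed (@fits L p n).
Proof.
move=> j0; elim: L p => [|L IH] p.
  rewrite (_ : @fits 0 p n = set0); first exact: closed0.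
  apply/seteqP; split=> // t [theta _].
  suff H L (th : params R D L p) : L <> 0 by exact: H theta erefl.
  by case: th.
rewrite fitsS; apply: closedU.
  by case: ifP => _; [exact: closed_fits_output|exact: closed0].
apply: closed_bigcup => [|k kn]; first exact: finite_II.
pose h (t : data p * ('M[R]_(k.+1, p) * 'cV[R]_k.+1)) : data k.+1 :=
  (hidden_data t.2 t.1.1.1, t.1.1.2, t.1.2 - frobenius t.2.1 ^+ 2).
apply: (@closed_exists_locally_bounded _ _ (h @^-1` @fits L k.+1 n)) => [|t].
  have [cZ cY cc cw] := data_continuous p ('M[R]_(k.+1, p) * 'cV[R]_k.+1)%type.
  have cw1 : continuous
      (fun u : data p * ('M[R]_(k.+1, p) * 'cV[R]_k.+1) => u.2.1).
    by move=> u; apply: (continuous_comp (cw u)); exact: cvg_fst.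
  have hc : continuous h.
    apply: continuous_pair; first apply: continuous_pair => //.
      exact: hidden_data_continuous.
    move=> t; apply: cvgB; first exact: cc.
    exact: (continuous_frobenius_sqr cw1).
  by apply: preimage_closed (IH k.+1) => t _; exact: hc.
(* Each entry of [W Z] is a sum of [p] products, of a weight at most [t.2 + 2] and a data entry at
   most [frobenius t.1.1 ^+ 2 + 2]. *)
pose B : R := p%:R * (`|t.2| + 2) * (frobenius t.1.1 ^+ 2 + 2).
exists ([set W : 'M[R]_(k.+1, p) | forall i j, `|W i j| <= t.2 + 2] `*`
  [set b : 'cV[R]_k.+1 | forall i j, `|b i j| <= B]).
  by apply: compact_setX; exact: compact_mx_box.
apply: filterS (near_data_bounded t) => u [u1 u2] w fits_w.
have w1 i j : `|w.1 i j| <= t.2 + 2.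
  case: fits_w => theta [_ _ /=]; have := frobenius_sqr_entry w.1 i j.
  have := sum_sq_weights_ge0 theta; lra.
have B0 : 0 <= B by rewrite !mulr_ge0 ?addr_ge0 ?sqr_ge0.
have wZ i j : `|(w.1 *m u.1.1) i j| <= B.
  rewrite mxE (le_trans (ler_norm_sum _ _ _))// /B -mulrA mulr_natl.
  rewrite -[X in _ *+ X]card_ord -sumr_const; apply: ler_sum => l _.
  rewrite normrM ler_pM//; first by apply: le_trans (w1 i l) _; have := ler_norm t.2; lra.
  by apply: le_trans (frobenius_sqr_entry u.1.1 l j) _; lra.
have [b [s [bB clamp]]] := clamp_bias B0 wZ.
(* The clamped bias is the bounded witness; the next layer absorbs the shift [s]. *)
exists (w.1, b); last exact: fits_translate clamp fits_w.
by split=> //= i j; rewrite [j]ord1.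
Qed.

End FittingData.

(** * Weak* continuity of point evaluations *)

Section WeakStarEvaluation.
Context {R : realType} {d : nat} {X : set 'cV[R]_d}.

(** The empty expression denotes the same zero molecule at cost 0. Hence constant sequences of
    molecules are Cauchy. *)
Lemma mol_norm_subrr (s : @mol_expr R d X) : mol_norm (mol_sub s s) = 0.
Proof.
have cost_ge0 t : 0 <= @mol_cost R d X t.
  by apply: sumr_ge0 => u _; rewrite mulr_ge0 ?enorm_ge0.
have cost0 : [set mol_cost t | t in [set t | mol_fun t = mol_fun (mol_sub s s)]] 0.
  exists [::]; last by rewrite /mol_cost big_nil.
  by rewrite /= mol_fun_sub; apply/funext => z; rewrite /mol_fun big_nil subrr.
apply/eqP; rewrite eq_le; apply/andP; split.
  by apply: ge_inf => //; exists 0 => _ [t _ <-]; exact: cost_ge0.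
by apply: lb_le_inf; [exists 0|move=> _ [t _ <-]; exact: cost_ge0].
Qed.

Definition elementary_molecule (y z : X) : AE X.
Proof.
refine (@MkAE R d X (fun=> [:: (1, y, z)]) _) => eps eps0.
by exists 0%N => m n _ _; rewrite mol_norm_subrr.
Defined.

Lemma ae_pair_elementary (y z : X) (g : X -> R) :
  ae_pair (elementary_molecule y z) g = g y - g z.
Proof.
by rewrite /ae_pair /mol_pair /= lim_cst// big_seq1 mul1r.
Qed.

Lemma wstar_functional_continuous (e : X) D i :
  continuous (wstar_functional e i : wstar e D -> R).
Proof.
move=> f.
have /cvg_sup/(_ i) := @cvg_id _ (nbhs (f : wstar e D)).
by move=> cvg_i A /(@initial_continuous _ _ (wstar_functional e i)) /cvg_i.
Qed.

(** The value [f_i(x_j)] is the pairing of [delta_(x_j) - delta_e] with [f_i - f_i(e)], plus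
    [f_i(e)]: a sum of two defining functionals of the topology. *)
Lemma sample_continuous (e : X) D N (x : 'I_N -> X) :
  continuous (sample x : wstar e D -> 'M[R]_(D, N)).
Proof.
apply: continuous_mx => i j.
pose m : AE X := elementary_molecule (x j) e.
rewrite (_ : (fun f => _) = (fun f : wstar e D =>
  wstar_functional e (inl (m, i)) f + wstar_functional e (inr i) f)).
  move=> f; exact: (cvgD (@wstar_functional_continuous e D (inl (m, i)) f)
                       (@wstar_functional_continuous e D (inr i) f)).
by apply/funext => f; rewrite mxE /= ae_pair_elementary subrr subr0 subrK.
Qed.

End WeakStarEvaluation.

(** * Minimization over the data values *)

Lemma closed_epigraph (R : realType) (T : topologicalType) (K : T -> \bar R) :
  lower_semicontinuous K -> closed [set t : T * R | (K t.1 <= t.2%:E)%E].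
Proof.
move=> Klsc; rewrite -[X in closed X]setCK; apply: open_closedC.
rewrite openE => -[t r] /= /negP; rewrite -ltNge => rK.
have [s rs sK] : exists2 s : R, r < s & (s%:E < K t)%E.
  case: (K t) rK => [k| |]//=.
    rewrite lte_fin => rk; exists ((r + k) / 2); rewrite ?lte_fin; lra.
  by move=> _; exists (r + 1); rewrite ?ltry// ltrDl.
have [V tV VK] := Klsc _ _ sK.
exists (V, [set y | y < s]) => /=; first by split=> //; exact: lt_nbhsl.
move=> [u y] /= [Vu ys]; apply/negP; rewrite -ltNge.
by apply: lt_trans (VK u Vu); rewrite lte_fin.
Qed.

Lemma penalized_min (R : realType) D N (G : 'M[R]_(D, N) -> \bar R)
    (E : set ('M[R]_(D, N) * R)) (mu : R) :
  (forall y, (0 <= G y)%E) -> lower_semicontinuous G -> coercive G -> 0 < mu ->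
  closed E -> E !=set0 -> (forall t, E t -> 0 <= t.2) ->
  exists2 t, E t & forall u, E u ->
    (G t.1 + (mu * t.2)%:E <= G u.1 + (mu * u.2)%:E)%E.
Proof.
move=> G0 Glsc Gco mu0 Ecl [t0 Et0] E0.
(* If [G] is infinite at every point of [E], any point of [E] is a minimizer. *)
have [[t1 [Et1 Gt1]]|Goo] := pselect (exists t, E t /\ (G t.1 < +oo)%E); last first.
  exists t0 => // u Eu; suff -> : G u.1 = +oo%E by rewrite addye// leey.
  apply/eqP; rewrite -leye_eq leNgt; apply/negP => Gu; apply: Goo; by exists u.
have G1 : G t1.1 \is a fin_num by rewrite ge0_fin_numE.
pose g1 := fine (G t1.1).
pose m1 := g1 + mu * t1.2.
(* A further variable bounding [G] from above makes the objective continuous; [A] is its sublevel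
   set at a reference point, compact by coercivity of [G] and by [mu > 0]. *)
pose A := [set t : ('M[R]_(D, N) * R) * R |
  [/\ E t.1, (G t.1.1 <= t.2%:E)%E & t.2 + mu * t.1.2 <= m1]].
have A1 : A (t1, g1) by split=> //=; rewrite fineK.
have cfst : continuous (fun t : ('M[R]_(D, N) * R) * R => t.1) by move=> t; exact: cvg_fst.
have csnd : continuous (fun t : ('M[R]_(D, N) * R) * R => t.2) by move=> t; exact: cvg_snd.
have c11 : continuous (fun t : ('M[R]_(D, N) * R) * R => t.1.1).
  by move=> t; apply: (continuous_comp (cfst t)); exact: cvg_fst.
have c12 : continuous (fun t : ('M[R]_(D, N) * R) * R => t.1.2).
  by move=> t; apply: (continuous_comp (cfst t)); exact: cvg_snd.
have cJ : continuous (fun t : ('M[R]_(D, N) * R) * R => t.2 + mu * t.1.2).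
  move=> t; apply: cvgD; first exact: csnd.
  by apply: cvgM; [exact: cvg_cst|exact: c12].
have Acl : closed A.
  rewrite (_ : A = fst @^-1` E `&` (fun t => (t.1.1, t.2)) @^-1`
    [set t | (G t.1 <= t.2%:E)%E] `&` (fun t => t.2 + mu * t.1.2) @^-1` [set x | x <= m1]).
    apply: closedI; last by apply: preimage_closed (@closed_le R m1) => t _; exact: cJ.
    apply: closedI; first by apply: preimage_closed Ecl => t _; exact: cfst.
    apply: preimage_closed (closed_epigraph Glsc) => t _.
    exact: (continuous_pair c11 csnd).
  by apply/seteqP; split=> [t []|t [[]]].
have A0 t : A t -> 0 <= t.1.2 /\ 0 <= t.2.
  by move=> [/E0 ? Gt _]; split=> //; rewrite -lee_fin; exact: le_trans Gt.
have [M GM] : exists M : R, forall y, (G y <= m1%:E)%E -> forall i j, `|y i j| <= M.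
  have [M [_ GM]] := Gco m1; exists (M + 1) => y Gy i j.
  apply: le_trans (GM (M + 1) _ y Gy); last by rewrite ltrDl.
  rewrite /Num.norm /= mx_normrE.
  exact: (le_bigmax _ (fun ij => `|y ij.1 ij.2|) (i, j)).
have Ac : compact A.
  apply: (subclosed_compact Acl (B := ([set y : 'M[R]_(D, N) | forall i j, `|y i j| <= M] `*`
     `[0, m1 / mu]) `*` `[0, m1])).
    by do ?apply: compact_setX; [exact: compact_mx_box|exact: segment_compact..].
  move=> [[y c] g] At; have /= [c0 g0] := A0 _ At; case: At => /= _ Gy J.
  have mc : 0 <= mu * c by rewrite mulr_ge0// ltW.
  split=> /=; last by rewrite in_itv/= g0; lra.
  split=> /=; last by rewrite in_itv/= c0 ler_pdivlMr// mulrC; lra.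
  by apply: GM; apply: le_trans Gy _; rewrite lee_fin; lra.
have [] := @compact_EVT_min _ R _ A (ex_intro _ _ A1) Ac (continuous_subspaceT cJ).
move=> [[y c] g]; rewrite inE => -[/= Eyc Gy J] Jmin.
exists (y, c) => //= -[y' c'] Eu /=.
have Jg : (G y + (mu * c)%:E <= (g + mu * c)%:E)%E by rewrite EFinD leeD2r.
apply: le_trans Jg _.
have := G0 y'; case Gy' : (G y') => [g'| |]// _; last by rewrite addye// leey.
(* A competitor outside [A] has objective above [m1] and so cannot do better. *)
rewrite -EFinD lee_fin; have [J'|/ltW J'] := leP (g' + mu * c') m1; last exact: le_trans J'.
by apply: (Jmin (y', c', g')); rewrite inE; split=> //=; rewrite Gy'.
Qed.

(** * Comparing the representation cost with the cost of fitting the data *)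

Section SampledCost.
Context {R : realType} {d D N : nat} {X : set 'cV[R]_d}.
Context (e : X) (x : 'I_N -> X).

Definition inputs : 'M[R]_(d, N) := \matrix_(i, j) val (x j) i ord0.

Lemma col_inputs j : col j inputs = val (x j).
Proof. by apply/matrixP => i i'; rewrite [i']ord1 mxE mxE. Qed.

Lemma sample_realization L (theta : params R D L d) Y :
  (forall j, net_fun theta (col j inputs) = col j Y) ->
  sample x (realization X theta) = Y.
Proof.
by move=> net_th; apply/matrixP => i j; rewrite mxE /= -col_inputs net_th mxE.
Qed.

Lemma fits_realization L (theta : params R D L d) : (0 < N)%N ->
  fits L (N ^ 2) (inputs, sample x (realization X theta), sum_sq_weights theta).
Proof.
move=> N0; have n0 : (0 < N ^ 2)%N by rewrite expn_gt0 N0.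
have [theta' [th_n net_th cost_th]] := narrow_network theta inputs n0 (leqnn _).
exists theta'; split=> //= j; rewrite net_th col_inputs.
by apply/matrixP => i i'; rewrite [i']ord1 [RHS]mxE mxE.
Qed.

(* The least cost of fitting the values of [f] at the data points is a w*-l.s.c.
   minorant of [param_rep_cost], hence of [rep_cost]. *)
Lemma rep_cost_fits L (f : Lip X D) (a : R) : (0 < N)%N -> (0 < L)%N ->
  (rep_cost e L f <= a%:E)%E -> fits L (N ^ 2) (inputs, sample x f, a * L%:R).
Proof.
move=> N0 L0; have j0 : 'I_N := Ordinal N0.
have L0R : 0 < L%:R :> R by rewrite ltr0n.
(* The factor [L%:R] converts the averaged cost into the sum of squares used by [fits]. *)
pose H (g : wstar e D) : \bar R :=
  ereal_inf [set c%:E | c in [set c | fits L (N ^ 2) (inputs, sample x g, c * L%:R)]].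
have mono (Y : 'M[R]_(D, N)) c c' : c <= c' -> fits L (N ^ 2) (inputs, Y, c) ->
    fits L (N ^ 2) (inputs, Y, c').
  by move=> cc' [theta [? ? /= th_c]]; exists theta; split=> //=; exact: le_trans cc'.
have fits_cl (Y : 'M[R]_(D, N)) : closed [set c | fits L (N ^ 2) (inputs, Y, c * L%:R)].
  apply: preimage_closed (closed_fits j0) => c _; move: c.
  apply: continuous_pair => c; first exact: cvg_cst.
  by apply: cvgM; [exact: cvg_id|exact: cvg_cst].
(* The admissible bounds form a closed and upward closed set, so the infimum itself is admissible;
   sublevel sets of [H] are thus preimages of [fits]. *)
have HP g b : (H g <= b%:E)%E <-> fits L (N ^ 2) (inputs, sample x g, b * L%:R).
  split=> [Hb|fits_b]; last by apply: ereal_inf_lbound; exists b.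
  apply: fits_cl => V /nbhs_ballP[eps /= eps0 epsV].
  have : (H g < (b + eps)%:E)%E by apply: le_lt_trans Hb _; rewrite lte_fin ltrDl.
  move=> /ereal_inf_lt[_ [c fits_c <-]]; rewrite lte_fin => cb.
  have [bc|cb'] := leP b c.
    exists c; split=> //; apply: epsV; rewrite /ball /= distrC ger0_norm; lra.
  exists b; split; last exact: epsV (ballxx _ eps0).
  by apply: mono fits_c; rewrite ler_wpM2r ?ltW.
move=> fa; apply/(HP f a); apply: le_trans fa.
apply: (@lsc_regularization_max _ _ _ H) => [|g].
  apply/lower_semicontinuous_closedP => b.
  rewrite (_ : [set _ | _] = (fun g : wstar e D =>
    (inputs, sample x g, b * L%:R)) @^-1` fits L (N ^ 2)).
    apply: preimage_closed (closed_fits j0) => g _; move: g.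
    apply: continuous_pair; last exact: cst_continuous.
    apply: continuous_pair; first exact: cst_continuous.
    exact: sample_continuous.
  by apply/seteqP; split=> g /= h; apply/HP.
(* Any network realizing the function can be narrowed on the data at no extra cost, so [H] lies
   below [param_rep_cost]. *)
apply: le_ereal_inf_tmp => _ [theta <- <-]; apply: ereal_inf_lbound.
exists (param_cost theta) => //=; rewrite /param_cost mulrAC mulVf ?gt_eqF// mul1r.
exact: fits_realization.
Qed.

End SampledCost.

(** A network witnessing membership of the minimizing data point in [fits] costs no more than the
    bound there, hence attains the minimum. *)
Lemma global_minimizer (R : realType) (d D L N : nat) (X : set 'cV[R]_d)
  (x : 'I_N -> X) (G : 'M[R]_(D, N) -> \bar R) (mu : R) :
  (0 < N)%N -> (0 < L)%N -> 0 < mu ->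
  (forall y, (0 <= G y)%E) -> lower_semicontinuous G -> coercive G ->
  exists2 theta : params R D L d, params_le (N ^ 2) theta &
    forall t, fits L (N ^ 2) (inputs x, t.1, t.2) ->
      (G (sample x (realization X theta)) + (mu * sum_sq_weights theta)%:E <=
       G t.1 + (mu * t.2)%:E)%E.
Proof.
move=> N0 L0 mu0 G0 Glsc Gco.
pose E := [set t : 'M[R]_(D, N) * R | fits L (N ^ 2) (inputs x, t.1, t.2)].
have [|||t [theta [/= th_n net_th th_c]] tmin] := @penalized_min _ _ _ G E mu G0 Glsc Gco mu0.
- apply: preimage_closed (closed_fits (Ordinal N0)) => t _; move: t.
  apply: continuous_pair; last by move=> t; exact: cvg_snd.
  by apply: continuous_pair => t; [exact: cvg_cst|exact: cvg_fst].
- have n0 : (0 < N ^ 2)%N by rewrite expn_gt0 N0.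
  have [theta _] := @params_inhabited R D L d _ L0 n0.
  by exists (sample x (realization X theta), sum_sq_weights theta); exact: fits_realization.
- by move=> t [theta [_ _]]; apply: le_trans; exact: sum_sq_weights_ge0.
exists theta => // u /tmin; apply: le_trans.
rewrite (sample_realization net_th) leeD2l// lee_fin ler_wpM2l//; exact: ltW.
Qed.

Theorem theorem9p6 (R : realType) (d D L N : nat)
  (hd : (1 <= d)%N) (hD : (1 <= D)%N) (hL : (2 <= L)%N) (hN : (1 <= N)%N)
  (X : set 'cV[R]_d) (e : X) (x : 'I_N -> X) (hx : injective x)
  (G : 'M[R]_(D, N) -> \bar R) (G_ge0 : forall y, (0 <= G y)%E)
  (G_proper : proper_fun G) (G_lsc : lower_semicontinuous G)
  (G_coercive : coercive G) (lambda : R) (hlambda : 0 < lambda) :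
  let solP : set (Lip X D) :=
    argmin (finite_rep_cost e L)
      (fun f => G (sample x f) + lambda%:E * rep_cost e L f)%E in
  [/\ solP !=set0,
      exists2 theta : params R D L d,
        params_le (N ^ 2) theta & solP (realization X theta)
    & forall K : nat, (N ^ 2 <= K)%N ->
        let solK : set (params R D L d) :=
          argmin (params_le K)
            (fun theta => G (sample x (realization X theta)) +
               (lambda / L%:R * sum_sq_weights theta)%:E)%E in
        solK !=set0 /\ forall theta, solK theta -> solP (realization X theta)].
Proof.
move=> solP; have L0 : (0 < L)%N := ltnW hL.
have LR : 0 < L%:R :> R by rewrite ltr0n.
have mu0 : 0 < lambda / L%:R by rewrite divr_gt0.
pose J (theta : params R D L d) := (G (sample x (realization X theta)) +
  (lambda / L%:R * sum_sq_weights theta)%:E)%E.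
have [theta0 th0_n th0_min] := global_minimizer x hN L0 mu0 G_ge0 G_lsc G_coercive.
have rep_le (theta : params R D L d) :
    (rep_cost e L (realization X theta) <= (param_cost theta)%:E)%E.
  by apply: le_trans (lsc_regularization_le _ _) _; apply: ereal_inf_lbound; exists theta.
(* One criterion serves all the claims: any network, of whatever width, doing as well as [theta0]
   solves (P). *)
have sol_of_le theta : (J theta <= J theta0)%E -> solP (realization X theta).
  move=> th_le; split=> [|f]; rewrite /finite_rep_cost /=.
    exact: le_lt_trans (rep_le theta) (ltry _).
  (* The value [-oo] is impossible: it would yield a network with a negative sum of squares. *)
  case rf : (rep_cost e L f) => [r| |] // _; last first.
    have : (rep_cost e L f <= (-1)%:E)%E by rewrite rf leNye.
    move=> /(rep_cost_fits x hN L0)[th [_ _ /= th_c]].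
    exfalso; have := sum_sq_weights_ge0 th; lra.
  have fits_f : fits L (N ^ 2) (inputs x, sample x f, r * L%:R).
    by apply: (rep_cost_fits (e := e)) => //; rewrite rf.
  (* The chain is [G(f) + lambda R_L(f) >= J theta0 >= J theta >= G(f_theta) + lambda
     R_L(f_theta)]. *)
  have := th0_min (_, _) fits_f; rewrite /= (_ : lambda / L%:R * (r * L%:R) = lambda * r).
    apply: le_trans; apply: le_trans th_le; rewrite /J leeD2l//.
    apply: (@le_trans _ _ (lambda%:E * (param_cost theta)%:E)%E).
      by rewrite lee_pmul2l.
    by rewrite -EFinM lee_fin /param_cost mulrA.
  by field; rewrite gt_eqF.
have th0_le theta : (J theta0 <= J theta)%E.
  exact: (th0_min (_, _) (fits_realization x theta hN)).
have solP0 := sol_of_le theta0 (lexx _).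
split; [by exists (realization X theta0)|by exists theta0|move=> K nK solK].
(* As [theta0] is admissible for [K] and optimal among all widths, every solution for [K] has
   objective at most [J theta0]. *)
have th0_K : params_le K theta0.
  by apply: sub_all th0_n => k /leq_trans; apply.
split; first by exists theta0; split=> [|u _]; [exact: th0_K|exact: th0_le].
by move=> theta [_ th_min]; apply: sol_of_le; exact: th_min.
Qed.
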